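(* For any constellation $[\mathbb{X},\mathbb{P}]$ (natural binary code labeling, bit probabilities $P_{C_k}(0)\in(0,1)$), the low-GMI parameters $[\boldsymbol{\mu},E_s,\alpha]$ of $[\mathbb{X},\mathbb{P}]$ are equal to the low-GMI parameters of the constellation $[\mathring{\mathbb{X}},\mathbb{U}_m]$, where $\mathring{\mathbb{X}}$ is the transform of $\mathbb{X}$ with respect to the bit probabilities of $\mathbb{P}$ and $\mathbb{U}_m$ is the uniform distribution.
   Context: Let $m\ge1$, $M=2^m$, $N\ge1$. For $0\le i\le M-1$, $n_{i,k}\in\{0,1\}$ is the $k$-th bit of $i$ ($i=\sum_k n_{i,k}2^k$), and $\bar b=1-b$. A constellation $[\mathbb{X},\mathbb{P}]$ consists of an alphabet $\mathbb{X}$ with rows $\boldsymbol{x}_0,\ldots,\boldsymbol{x}_{M-1}\in\mathbb{R}^N$, symbol $\boldsymbol{x}_i$ carrying the label $(n_{i,0},\ldots,n_{i,m-1})$, and distribution $P_i=\prod_kP_{C_k}(n_{i,k})$ determined by bit probabilities $P_{C_k}(0)$, $P_{C_k}(1)=1-P_{C_k}(0)$; i.e. independent bits $C_k$ with $\Pr(C_k=u)=P_{C_k}(u)$ select $\boldsymbol{X}=\boldsymbol{x}_i$, $i=\sum_kC_k2^k$. $\mathbb{U}_m$ is the case $P_{C_k}(0)=1/2$ for all $k$ (all $P_i=1/M$). The transform $\mathring{\mathbb{X}}$ has rows $\mathring{\boldsymbol{x}}_i=\sum_j\boldsymbol{x}_j\gamma_{i,j}\sqrt{P_j}$ with $\gamma_{i,j}=\prod_{k}\big[(-1)^{\bar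 n_{i,k}n_{j,k}}\sqrt{P_{C_k}(0)}+(-1)^{n_{i,k}\bar n_{j,k}}\sqrt{P_{C_k}(1)}\big]$. Channel: $\boldsymbol{Y}=\boldsymbol{H}\circ\boldsymbol{X}+\boldsymbol{Z}$, $\boldsymbol{Z}$ zero-mean Gaussian with variance $N_0/2$ per dimension, $\boldsymbol{H}$ real fading vector with common marginal pdf $p_H$, known at the receiver (standard regularity conditions assumed). $\mathrm{SNR}=\mathbb{E}[H^2]E_s/N_0$. BICM-GMI: $I(\mathrm{SNR})=\sum_kI(C_k;\boldsymbol{Y}\mid\boldsymbol{H})$ in bits, as a function of SNR. Low-GMI parameters: $\boldsymbol{\mu}=\mathbb{E}[\boldsymbol{X}]$, $E_s=\mathbb{E}[\|\boldsymbol{X}\|^2]$, $\alpha=\frac{dI}{d\,\mathrm{SNR}}\big|_{\mathrm{SNR}=0}$. *)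

(* Defs.v *)
From HB Require Import structures.
From mathcomp Require Import all_boot all_order all_algebra.
From mathcomp Require Import all_classical all_reals all_analysis.
Set Implicit Arguments. Unset Strict Implicit. Unset Printing Implicit Defensive.
Import Order.TTheory GRing.Theory Num.Theory.
Import numFieldNormedType.Exports.
Local Open Scope classical_set_scope.
Local Open Scope ring_scope.

Section Defs.
Variable R : realType.

Definition bit (i k : nat) : bool := odd (i %/ 2 ^ k).

Definition Pbit (m : nat) (p0 : 'I_m -> R) (k : 'I_m) (b : bool) : R :=
  if b then 1 - p0 k else p0 k.

Definition Psym (m : nat) (p0 : 'I_m -> R) (i : nat) : R :=
  \prod_(k < m) Pbit p0 k (bit i k).

Definition unif_bits (m : nat) : 'I_m -> R := fun _ => 2^-1.

Definition gamma (m : nat) (p0 : 'I_m -> R) (i j : nat) : R :=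
  \prod_(k < m)
    ((-1) ^+ ((~~ bit i k) && bit j k) * Num.sqrt (p0 k)
     + (-1) ^+ (bit i k && ~~ bit j k) * Num.sqrt (1 - p0 k)).

Definition transform (m N : nat) (p0 : 'I_m -> R) (X : 'M[R]_(2 ^ m, N))
  : 'M[R]_(2 ^ m, N) :=
  \matrix_(i < 2 ^ m, d < N)
     \sum_(j < 2 ^ m) X j d * gamma p0 i j * Num.sqrt (Psym p0 j).

Definition mean (m N : nat) (p0 : 'I_m -> R) (X : 'M[R]_(2 ^ m, N)) : 'rV[R]_N :=
  \row_(d < N) \sum_(i < 2 ^ m) Psym p0 i * X i d.

Definition energy (m N : nat) (p0 : 'I_m -> R) (X : 'M[R]_(2 ^ m, N)) : R :=
  \sum_(i < 2 ^ m) Psym p0 i * \sum_(d < N) X i d ^+ 2.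

Definition log2 (x : R) : R := ln x / ln 2.

(* Gaussian density of N(mean, N0/2 per dimension) on R^N *)
Definition gauss (N : nat) (N0 : R) (y mu : 'I_N -> R) : R :=
  \prod_(d < N) ((Num.sqrt (pi * N0))^-1 * expR (- (y d - mu d) ^+ 2 / N0)).

Definition cond_dens (m N : nat) (p0 : 'I_m -> R) (X : 'M[R]_(2 ^ m, N))
  (N0 : R) (k : 'I_m) (u : bool) (h y : 'I_N -> R) : R :=
  \sum_(j < 2 ^ m | bit j k == u)
     Psym p0 j / Pbit p0 k u * gauss N0 y (fun d => h d * X j d).

Definition out_dens (m N : nat) (p0 : 'I_m -> R) (X : 'M[R]_(2 ^ m, N))
  (N0 : R) (h y : 'I_N -> R) : R :=
  \sum_(j < 2 ^ m) Psym p0 j * gauss N0 y (fun d => h d * X j d).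

Definition EH2 (pH : R -> R) : R :=
  Rintegral lebesgue_measure setT (fun x => x ^+ 2 * pH x).

Definition channel_model (d0 : measure_display) (T : measurableType d0) (N : nat)
  (P : probability T R) (H Z : 'I_N -> T -> R) (pH : R -> R) : Prop :=
  (forall d, measurable_fun setT (H d)) /\
      (forall d, measurable_fun setT (Z d)) /\
      measurable_fun setT pH /\ (forall x, 0 <= pH x) /\
      (forall d (A : set R), measurable A ->
         P (H d @^-1` A) = (\int[lebesgue_measure]_(x in A) (pH x)%:E)%E) /\
      (forall d (A : set R), measurable A ->
         P (Z d @^-1` A) =
         (\int[lebesgue_measure]_(x in A)
             ((Num.sqrt (2 * pi))^-1 * expR (- x ^+ 2 / 2))%:E)%E) /\
      (* mutual independence of Z_0,...,Z_{N-1} and the vector H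
         (product rule on measurable rectangles) *)
      (forall A B : 'I_N -> set R, (forall d, measurable (A d)) ->
         (forall d, measurable (B d)) ->
         P [set t | forall d, A d (Z d t) /\ B d (H d t)] =
         ((\prod_(d < N) P (Z d @^-1` A d)) *
           P [set t | forall d, B d (H d t)])%E) /\
      (\int[lebesgue_measure]_x (x ^+ 2 * pH x)%:E < +oo)%E.

(* I(C_k ; Y | H) in bits for noise level N0:
   sum_i P_i E_{H,Z}[ log2 p(Y|C_k=n_{i,k},H) / p(Y|H) ], Y = H o x_i + Z *)
Definition bit_MI (d0 : measure_display) (T : measurableType d0) (m N : nat)
  (P : probability T R) (H Z : 'I_N -> T -> R)
  (p0 : 'I_m -> R) (X : 'M[R]_(2 ^ m, N)) (N0 : R) (k : 'I_m) : R :=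
  \sum_(i < 2 ^ m) Psym p0 i *
    Rintegral P setT (fun t =>
      let h := fun d => H d t in
      let y := fun d => h d * X i d + Num.sqrt (N0 / 2) * Z d t in
      log2 (cond_dens p0 X N0 k (bit i k) h y / out_dens p0 X N0 h y)).

(* BICM-GMI as a function of SNR = E[H^2] E_s / N0 *)
Definition GMI (d0 : measure_display) (T : measurableType d0) (m N : nat)
  (P : probability T R) (H Z : 'I_N -> T -> R) (pH : R -> R)
  (p0 : 'I_m -> R) (X : 'M[R]_(2 ^ m, N)) (snr : R) : R :=
  let N0 := EH2 pH * energy p0 X / snr in
  \sum_(k < m) bit_MI P H Z p0 X N0 k.

(* alpha is the (right) derivative of GMI at SNR = 0, where GMI(0) = 0:
   has_alpha ... a  <->  GMI(snr)/snr --> a as snr -> 0+ *)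
Definition has_alpha (d0 : measure_display) (T : measurableType d0) (m N : nat)
  (P : probability T R) (H Z : 'I_N -> T -> R) (pH : R -> R)
  (p0 : 'I_m -> R) (X : 'M[R]_(2 ^ m, N)) (a : R) : Prop :=
  (fun snr => GMI P H Z pH p0 X snr / snr) @ 0^'+ --> a.

End Defs.

(* Main.v *)
(** Put [e = N0 ^ (-1/2)], so that [e ^+ 2] is proportional to the SNR. When
    symbol [i] is sent, the likelihood of symbol [j] is, up to a factor free of
    [j], [exp (e l_ij - e^2 q_ij)] with [l_ij] linear in the products [h_d z_d]
    and [q_ij] quadratic in the [h_d]. Hence each bit information is an averaged
    difference of two functions [ln (sum_j Q_j exp (e l_ij - e^2 q_ij))]. Their
    first-order terms cancel after averaging over [i], and their second-order
    remainders, divided by [e^2], are dominated by a multiple of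
    [sum_d h_d^2 (1 + z_d^2)], which is integrable because fading and noise are
    independent with finite second moments. Dominated convergence thus shows
    that alpha exists and depends on the constellation only through [E_s] and
    the covariances of the conditional means [E[X | C_k]]. The transform is, in
    suitable coordinates, an orthogonal map that is a tensor product over the
    bits, and it preserves the mean, the energy and these covariances.
    If [E[H^2] E_s = 0], then [N0 = 0] and every density takes the junk value
    [0], so that both GMI functions vanish identically. *)

Require Import Defs.
From HB Require Import structures.
From mathcomp Require Import all_boot all_order all_algebra.
From mathcomp Require Import all_classical all_reals all_analysis.
From mathcomp Require Import measurable_realfun ring lra.
Set Implicit Arguments. Unset Strict Implicit. Unset Printing Implicit Defensive.
Import Order.TTheory GRing.Theory Num.Theory.
Import numFieldNormedType.Exports.
Local Open Scope classical_set_scope.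
Local Open Scope ring_scope.

(** * Binary digits and sums over all labels *)

Section BitSums.
Context {R : realType}.

Lemma bitS (i k : nat) : bit i k.+1 = bit (i %/ 2) k.
Proof. by rewrite /bit expnS divnMA. Qed.

Lemma bit_small (i k : nat) : (i < 2 ^ k)%N -> bit i k = false.
Proof. by move=> ik; rewrite /bit divn_small. Qed.

Lemma bit_add_low (m i k : nat) : (k < m)%N -> bit (2 ^ m + i) k = bit i k.
Proof.
move=> km; rewrite /bit divnDl ?dvdn_exp2l 1?ltnW// -expnB 1?ltnW//.
by rewrite oddD oddX subn_eq0 leqNgt km.
Qed.

Lemma bit_add_top (m i : nat) : (i < 2 ^ m)%N -> bit (2 ^ m + i) m = true.
Proof.
by move=> im; rewrite /bit divnDl ?dvdnn// divnn expn_gt0 divn_small ?addn0.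
Qed.

Lemma bit_inj (m i j : nat) : (i < 2 ^ m)%N -> (j < 2 ^ m)%N ->
  (forall k, (k < m)%N -> bit i k = bit j k) -> i = j.
Proof.
elim: m i j => [|m IH] i j; first by rewrite expn0 !ltnS !leqn0 => /eqP-> /eqP->.
move=> im jm eqb; rewrite (divn_eq i 2) (divn_eq j 2) !modn2.
have := eqb 0%N isT; rewrite /bit expn0 !divn1 => ->; congr (_ * _ + _)%N.
by apply: IH => [||k km]; rewrite ?ltn_divLR -?expnSr// -!bitS eqb.
Qed.

(** Induction on [m], splitting off the top bit: it is clear on the lower half of the index range
    and set on the upper half. This reduces symbol sums to one computation per bit. *)
Lemma sum_prod_bit (m : nat) (f : 'I_m -> bool -> R) :
  \sum_(i < 2 ^ m) \prod_(k < m) f k (bit i k) =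
  \prod_(k < m) (f k false + f k true).
Proof.
elim: m f => [|m IH] f.
  by rewrite expn0 big_ord1 !big_ord0.
pose F (n : nat) := \prod_(k < m.+1) f k (bit n k).
rewrite -(big_mkord xpredT F) expnS mul2n -addnn.
rewrite (big_cat_nat (n := (2 ^ m)%N)) ?leq_addr//=.
rewrite -[X in index_iota X (_ + _)]add0n big_addn addnK !big_mkord.
rewrite big_ord_recr/= mulrDr.
rewrite -(IH (fun k => f (widen_ord (leqnSn m) k))) !mulr_suml.
congr (_ + _); apply: eq_bigr => i _.
  by rewrite /F big_ord_recr/= bit_small.
rewrite /F big_ord_recr/= addnC bit_add_top//; congr (_ * _).
by apply: eq_bigr => k _; rewrite bit_add_low.
Qed.

End BitSums.

(** * Conditional means, bit covariances and the transform *)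

Section Constellation.
Context {R : realType} {m N : nat}.
Implicit Types (p : 'I_m -> R) (X : 'M[R]_(2 ^ m, N)).

Definition cond_mean p X (k : 'I_m) (u : bool) (d : 'I_N) : R :=
  \sum_(j < 2 ^ m | bit j k == u) Psym p j / Pbit p k u * X j d.

(** The [(d, e)] entry of the covariance matrix of the random vector E[X | C_k]. *)
Definition bit_cov p X (k : 'I_m) (d e : 'I_N) : R :=
  \sum_(i < 2 ^ m) Psym p i *
    ((cond_mean p X k (bit i k) d - mean p X 0 d) *
     (cond_mean p X k (bit i k) e - mean p X 0 e)).

(** As a 2 by 2 matrix in [(b, c)] this is sqrt 2 times an orthogonal matrix when [0 < p k < 1];
    [gamma] is the product of these factors over the bits. *)
Definition gamma_factor p (k : 'I_m) (b c : bool) : R :=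
  (-1) ^+ (~~ b && c) * Num.sqrt (p k)
  + (-1) ^+ (b && ~~ c) * Num.sqrt (1 - p k).

Lemma Pbit_gt0 p k b : 0 < p k < 1 -> 0 < Pbit p k b.
Proof. by case: b => /andP[] //=; rewrite subr_gt0. Qed.

Lemma Psym_gt0 p i : (forall k, 0 < p k < 1) -> 0 < Psym p i.
Proof. by move=> hp; apply: prodr_gt0 => k _; exact: Pbit_gt0. Qed.

Lemma unif_bits_itv (k : 'I_m) : 0 < @unif_bits R m k < 1.
Proof. by rewrite /unif_bits; apply/andP; split; lra. Qed.

Lemma Pbit_unif (k : 'I_m) b : Pbit (@unif_bits R m) k b = 2^-1.
Proof. by case: b => //=; rewrite /unif_bits; field. Qed.

Lemma sum_Psym p : \sum_(i < 2 ^ m) Psym p i = 1.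
Proof.
by rewrite sum_prod_bit big1// => k _; rewrite /Pbit addrC subrK.
Qed.

Lemma sum_Psym_bit p (k : 'I_m) (f : bool -> R) :
  \sum_(i < 2 ^ m) Psym p i * f (bit i k) =
  p k * f false + (1 - p k) * f true.
Proof.
pose g (k' : 'I_m) b := Pbit p k' b * (if k' == k then f b else 1).
transitivity (\sum_(i < 2 ^ m) \prod_(k' < m) g k' (bit i k')).
  apply: eq_bigr => i _; rewrite big_split/=; congr (_ * _).
  by rewrite (bigD1 k)//= eqxx big1 ?mulr1// => k' /negbTE ->.
rewrite sum_prod_bit (bigD1 k)//= big1 ?mulr1.
  by rewrite /g eqxx.
by move=> k' /negbTE nk; rewrite /g nk /Pbit !mulr1 addrC subrK.
Qed.

Lemma mean_cond_mean p X (k : 'I_m) d : 0 < p k < 1 ->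
  mean p X 0 d = p k * cond_mean p X k false d
                + (1 - p k) * cond_mean p X k true d.
Proof.
move=> hk; rewrite mxE (bigID (fun i : 'I_(2 ^ m) => bit i k == false))/=.
rewrite /cond_mean !mulr_sumr; congr (_ + _); last first.
  apply: eq_big => [i|i _]; first by case: bit.
  by rewrite mulrA mulrCA divff ?mulr1// (gt_eqF (@Pbit_gt0 p k true hk)).
apply: eq_bigr => i _.
by rewrite mulrA mulrCA divff ?mulr1// (gt_eqF (@Pbit_gt0 p k false hk)).
Qed.

Lemma sum_cond_mean p X (k : 'I_m) d : 0 < p k < 1 ->
  \sum_(i < 2 ^ m) Psym p i * cond_mean p X k (bit i k) d = mean p X 0 d.
Proof.
move=> hk.
by rewrite (sum_Psym_bit p k (cond_mean p X k ^~ d)) (mean_cond_mean _ _ hk).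
Qed.

(** E[X | C_k] takes only two values, so its covariance matrix has rank at most one and is
    determined by their difference. *)
Lemma bit_covE p X (k : 'I_m) d e : 0 < p k < 1 ->
  bit_cov p X k d e = p k * (1 - p k) *
    (cond_mean p X k false d - cond_mean p X k true d) *
    (cond_mean p X k false e - cond_mean p X k true e).
Proof.
move=> hk; rewrite /bit_cov (sum_Psym_bit p k (fun b =>
  (cond_mean p X k b d - mean p X 0 d) *
  (cond_mean p X k b e - mean p X 0 e))).
by rewrite !(mean_cond_mean _ _ hk); ring.
Qed.

(** Exchanging the sums leaves, for each [j], a sum over [i] that factorises over the bits. Constant
    [f] gives the mean; a sign on one bit gives the difference of conditional means. *)
Lemma sum_prod_transform p X (f : 'I_m -> bool -> R) d :
  \sum_(i < 2 ^ m) (\prod_k f k (bit i k)) * transform p X i d =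
  \sum_(j < 2 ^ m) X j d * Num.sqrt (Psym p j) *
    \prod_k (f k false * gamma_factor p k false (bit j k)
           + f k true * gamma_factor p k true (bit j k)).
Proof.
under eq_bigr do rewrite mxE mulr_sumr.
rewrite exchange_big/=; apply: eq_bigr => j _.
rewrite -(sum_prod_bit (fun k b => f k b * gamma_factor p k b (bit j k))).
rewrite mulr_sumr; apply: eq_bigr => i _.
by rewrite big_split/= -[gamma _ _ _]/(\prod_k gamma_factor _ _ _ _); ring.
Qed.

Lemma sqrt_Psym p i : (forall k, 0 < p k < 1) ->
  Num.sqrt (Psym p i) = \prod_k Num.sqrt (Pbit p k (bit i k)).
Proof.
move=> hp; rewrite /Psym; elim/big_rec2: _ => [|k x y _ <-]; first exact: sqrtr1.
by rewrite sqrtrM// ltW// Pbit_gt0.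
Qed.

Lemma gamma_factor_mean p (k : 'I_m) c :
  2^-1 * gamma_factor p k false c + 2^-1 * gamma_factor p k true c
  = Num.sqrt (Pbit p k c).
Proof. by rewrite /gamma_factor /Pbit; case: c => /=; field. Qed.

Lemma gamma_factor_diff p (k : 'I_m) c :
  2^-1 * gamma_factor p k false c - 2^-1 * gamma_factor p k true c
  = (-1) ^+ c * Num.sqrt (Pbit p k (~~ c)).
Proof. by rewrite /gamma_factor /Pbit; case: c => /=; field. Qed.

Lemma gamma_factor_dot p (k : 'I_m) b c : 0 < p k < 1 ->
  2^-1 * (gamma_factor p k false b * gamma_factor p k false c) +
  2^-1 * (gamma_factor p k true b * gamma_factor p k true c) = (b == c)%:R.
Proof.
move=> /andP[h0 h1]; have /sqr_sqrtr := ltW h0.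
have /sqr_sqrtr : 0 <= 1 - p k by rewrite subr_ge0 ltW.
rewrite /gamma_factor; set s := Num.sqrt (1 - _); set t := Num.sqrt _ => hs ht.
by case: b; case: c => /=; rewrite !expr1 !expr0; field: hs ht.
Qed.

(** Averaging [gamma] over its first index yields the square root of [Psym p j], which meets the
    same square root in the transform. *)
Lemma mean_transform p X : (forall k, 0 < p k < 1) ->
  mean (@unif_bits R m) (transform p X) = mean p X.
Proof.
move=> hp; apply/rowP => d; rewrite !mxE.
rewrite (eq_bigr (fun i : 'I_(2 ^ m) =>
  (\prod_(k < m) 2^-1) * transform p X i d)); last first.
  by move=> i _; rewrite /Psym; under eq_bigr do rewrite Pbit_unif.
rewrite (sum_prod_transform p X (fun _ _ => 2^-1)); apply: eq_bigr => j _.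
under eq_bigr do rewrite gamma_factor_mean.
by rewrite -sqrt_Psym// -mulrA -expr2 sqr_sqrtr ?ltW ?Psym_gt0// mulrC.
Qed.

(** The sum factorises into the dot products of [gamma_factor_dot]; distinct labels differ in some
    bit, whose factor vanishes. *)
Lemma gamma_dot p (i j : 'I_(2 ^ m)) : (forall k, 0 < p k < 1) ->
  \sum_(l < 2 ^ m) Psym (@unif_bits R m) l * (gamma p l i * gamma p l j)
  = (i == j)%:R.
Proof.
move=> hp; pose f k b := 2^-1 *
  (gamma_factor p k b (bit i k) * gamma_factor p k b (bit j k)).
transitivity (\sum_(l < 2 ^ m) \prod_(k < m) f k (bit l k)).
  apply: eq_bigr => l _; rewrite /f !big_split/=; congr (_ * _).
  by apply: eq_bigr => k _; rewrite Pbit_unif.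
rewrite sum_prod_bit /f; under eq_bigr do rewrite gamma_factor_dot//.
have [->|ij] := eqVneq i j; first by rewrite big1// => k _; rewrite eqxx.
have [k bk] : exists k : 'I_m, bit i k != bit j k.
  apply/existsP; apply: contraNT ij => /existsPn bij; apply/eqP/val_inj.
  apply: (bit_inj (ltn_ord i) (ltn_ord j)) => k km.
  by have := bij (Ordinal km); rewrite negbK => /eqP.
by rewrite (bigD1 k)//= (negbTE bk) mul0r.
Qed.

(** Parseval's identity for each coordinate [d], applied to the vector [a]: by [gamma_dot] only the
    diagonal of the double sum survives. *)
Lemma energy_transform p X : (forall k, 0 < p k < 1) ->
  energy (@unif_bits R m) (transform p X) = energy p X.
Proof.
move=> hp; rewrite /energy.
under eq_bigr do rewrite mulr_sumr.
under [RHS]eq_bigr do rewrite mulr_sumr.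
rewrite exchange_big [RHS]exchange_big/=; apply: eq_bigr => d _.
pose a j := X j d * Num.sqrt (Psym p j).
transitivity (\sum_(i < 2 ^ m) \sum_(j < 2 ^ m) a i * a j *
  \sum_(l < 2 ^ m) Psym (@unif_bits R m) l * (gamma p l i * gamma p l j)).
  under [RHS]eq_bigr do (under eq_bigr do rewrite mulr_sumr; rewrite exchange_big/=).
  rewrite [RHS]exchange_big/=; apply: eq_bigr => l _.
  rewrite mxE expr2 mulr_suml mulr_sumr; apply: eq_bigr => i _.
  by rewrite !mulr_sumr; apply: eq_bigr => j _; rewrite /a; ring.
apply: eq_bigr => i _; rewrite (bigD1 i)//= gamma_dot// eqxx mulr1 big1 ?addr0.
  rewrite /a mulrACA -expr2 -[Num.sqrt _ * _]expr2 sqr_sqrtr 1?mulrC//.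
  by rewrite ltW// Psym_gt0.
by move=> j ji; rewrite gamma_dot// eq_sym (negbTE ji) mulr0.
Qed.

Lemma diff_cond_mean p X (k : 'I_m) d :
  cond_mean p X k false d - cond_mean p X k true d =
  \sum_(j < 2 ^ m) Psym p j * ((-1) ^+ bit j k / Pbit p k (bit j k)) * X j d.
Proof.
rewrite [RHS](bigID (fun i : 'I_(2 ^ m) => bit i k == false))/=; congr (_ + _).
  by apply: eq_bigr => i /eqP ->; rewrite expr0; ring.
rewrite /cond_mean -sumrN; apply: eq_big => [i|i /eqP ->]; first by case: bit.
by rewrite expr1; ring.
Qed.

(** By [bit_covE], the difference of conditional means scaled by the square root of
    [p k * (1 - p k)] determines the bit covariance; for uniform bits that scale is [2^-1]. *)
Lemma diff_cond_mean_transform p X (k : 'I_m) d : (forall k, 0 < p k < 1) ->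
  2^-1 * (cond_mean (@unif_bits R m) (transform p X) k false d
        - cond_mean (@unif_bits R m) (transform p X) k true d) =
  Num.sqrt (p k) * Num.sqrt (1 - p k) *
    (cond_mean p X k false d - cond_mean p X k true d).
Proof.
move=> hp; rewrite !diff_cond_mean !mulr_sumr.
(* The prefactor [2^-1] cancels the division by [Pbit] in the signed sum, so its coefficients become
   a product over bits. *)
pose f (l : 'I_m) (b : bool) : R := 2^-1 * (if l == k then (-1) ^+ b else 1).
rewrite (eq_bigr (fun i : 'I_(2 ^ m) =>
  (\prod_(k' < m) f k' (bit i k')) * transform p X i d)); last first.
  move=> i _; rewrite mulrA /f big_split/=; congr (_ * _).
  have -> : \prod_(l < m) (if l == k then (-1) ^+ bit i l else 1)
      = (-1) ^+ bit i k :> R.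
    by rewrite (bigD1 k)//= eqxx big1 ?mulr1// => l /negbTE ->.
  rewrite Pbit_unif.
  have -> : Psym (@unif_bits R m) i = \prod_(l < m) 2^-1.
    by apply: eq_bigr => l _; rewrite Pbit_unif.
  by field.
rewrite (sum_prod_transform p X f); apply: eq_bigr => j _.
rewrite /f (bigD1 k)//= eqxx expr0 expr1 mulr1 mulrN1 mulNr gamma_factor_diff.
under eq_bigr => k' /negbTE nk.
  rewrite nk !mulr1 gamma_factor_mean; over.
rewrite sqrt_Psym// /Psym (bigD1 k)//= [in RHS](bigD1 k)//=.
(* [A] gathers the other bits and occurs squared on both sides, so only bit [k] is left to
   compare. *)
set A := \prod_(i < m | i != k) Num.sqrt _.
have -> : \prod_(i < m | i != k) Pbit p i (bit j i) = A ^+ 2.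
  rewrite /A expr2 -big_split/=; apply: eq_bigr => i _.
  by rewrite -expr2 sqr_sqrtr// ltW// Pbit_gt0.
have := hp k; set b := bit j k => hk.
have P0 := Pbit_gt0 b hk.
have h0 := sqr_sqrtr (ltW (@Pbit_gt0 p k false hk)).
have h1 := sqr_sqrtr (ltW (@Pbit_gt0 p k true hk)).
move: P0 h0 h1; rewrite /Pbit/=.
case: b => /=; set s := Num.sqrt (p k); set t := Num.sqrt (1 - _) => P0 h0 h1;
  rewrite ?expr1 ?expr0.
- have -> : 1 - p k = t ^+ 2 by [].
  by field; rewrite -sqrf_eq0 h1 gt_eqF.
- have -> : p k = s ^+ 2 by [].
  by field; rewrite -sqrf_eq0 h0 gt_eqF.
Qed.

Lemma bit_cov_transform p X (k : 'I_m) d e : (forall k, 0 < p k < 1) ->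
  bit_cov (@unif_bits R m) (transform p X) k d e = bit_cov p X k d e.
Proof.
move=> hp; rewrite !bit_covE ?unif_bits_itv//.
have /andP[h0 h1] := hp k.
have hs := sqr_sqrtr (ltW h0).
have ht : Num.sqrt (1 - p k) ^+ 2 = 1 - p k by rewrite sqr_sqrtr// subr_ge0 ltW.
have := diff_cond_mean_transform X k d hp.
have := diff_cond_mean_transform X k e hp.
set ae := cond_mean (@unif_bits R m) _ _ _ _ - _.
set ad := cond_mean (@unif_bits R m) _ _ _ _ - _.
set be := cond_mean _ _ _ _ _ - _; set bd := cond_mean _ _ _ _ _ - _ => he hd.
transitivity ((2^-1 * ad) * (2^-1 * ae)); first by rewrite /unif_bits; field.
have -> : p k * (1 - p k) = Num.sqrt (p k) ^+ 2 * Num.sqrt (1 - p k) ^+ 2.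
  by rewrite hs ht.
by rewrite hd he; ring.
Qed.

End Constellation.

(** * Second-order expansion of log-sum-exp functions *)

Lemma cvg_sumr (R : realType) (I : Type) (r : seq I) (f : I -> R^nat)
    (a : I -> R) : (forall i, f i @ \oo --> a i) ->
  (fun n => \sum_(i <- r) f i n) @ \oo --> \sum_(i <- r) a i.
Proof.
move=> fa; elim: r => [|i r IH].
  by rewrite big_nil; under eq_fun do rewrite big_nil; exact: cvg_cst.
by rewrite big_cons; under eq_fun do rewrite big_cons; exact: cvgD.
Qed.

Section LogSumExp.
Context {R : realType} {J : finType}.
Implicit Types (Q l q : J -> R) (e : R).

(** Since [expR a <= 1 / (1 - a)], it suffices that [1 - a] times the right-hand side, which is
    [1 + a ^+ 2 * (1 - 2 * a)], is at least 1. *)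
Lemma expR_le_quad (a : R) : a <= 2^-1 -> expR a <= 1 + a + 2 * a ^+ 2.
Proof.
move=> ha; have h := expR_ge1Dx (- a).
have a1 : 0 < 1 - a by lra.
rewrite -[a in expR a]opprK expRN -[leRHS]invrK lef_pV2 ?posrE ?expR_gt0//.
  apply: le_trans h; rewrite -[leLHS]mulr1 ler_pdivrMl; last by nra.
  by nra.
by rewrite invr_gt0; nra.
Qed.

(** Mean value theorem for the remainder [f], whose derivative lies between 0 and [2 * x ^+ 2] when
    [x <= 2^-1]. *)
Lemma expR_taylor2 (a : R) : `|a| <= 2^-1 ->
  `|expR a - 1 - a - a ^+ 2 / 2| <= 2 * `|a| ^+ 3.
Proof.
move=> ha; pose f (x : R) := expR x - 1 - x - x ^+ 2 / 2.
pose df (x : R) := expR x - 1 - x.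
have fd (x : R) : is_derive x 1 f (df x).
  rewrite /f /df; apply: is_derive_eq; rewrite -![_ *: _]/(_ * _).
  by field.
have fc A : {within A, continuous f}%classic.
  apply: continuous_subspaceT => x; apply: differentiable_continuous.
  by apply/derivable1_diffP; have := fd x; case.
have f0 : f 0 = 0 by rewrite /f expR0 expr0n/=; ring.
have bnd c : `|c| <= `|a| -> `|df c| <= 2 * `|a| ^+ 2.
  move=> ca; have : c <= 2^-1 by rewrite (le_trans (ler_norm c))// (le_trans ca).
  move=> /expR_le_quad h1; have h2 := expR_ge1Dx c.
  rewrite ger0_norm /df; last by lra.
  have : c ^+ 2 <= `|a| ^+ 2 by rewrite -(real_normK (num_real c)) lerXn2r ?nnegrE.
  by lra.
rewrite -[_ - _]/(f a); have [a0|/ltW a0] := leP 0 a.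
  have [c] := MVT_segment a0 (fun x _ => fd x) (@fc _).
  rewrite in_itv/= => /andP[c0 ca]; rewrite f0 !subr0 => ->.
  rewrite normrM exprSr mulrA ler_wpM2r// bnd// !ger0_norm//.
have [c] := MVT_segment a0 (fun x _ => fd x) (@fc _).
rewrite in_itv/= => /andP[c0 ca]; rewrite f0 !sub0r => /eqP; rewrite eqr_oppLR => /eqP ->.
rewrite normrN normrM normrN exprSr mulrA ler_wpM2r// bnd// !ler0_norm//.
by rewrite lerN2.
Qed.

(** Once |e c| is at most 1/2, the cubic Taylor bound leaves, after division by e^2, an error of at
    most 2 e |c|^3. *)
Lemma cvg_expR_second_order (e c : R^nat) (c0 : R) :
  (forall n, 0 < e n) -> e @ \oo --> (0 : R) -> c @ \oo --> c0 ->
  (fun n => (expR (e n * c n) - 1 - e n * c n) / e n ^+ 2) @ \oo --> c0 ^+ 2 / 2.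
Proof.
move=> e0 ec cc.
have ecc : (fun n => e n * c n) @ \oo --> (0 : R).
  by rewrite -(mul0r c0); exact: cvgM.
pose r n := (expR (e n * c n) - 1 - e n * c n) / e n ^+ 2 - c n ^+ 2 / 2.
have r0 : r @ \oo --> (0 : R).
  have bc : (fun n => 2 * e n * `|c n| ^+ 3) @ \oo --> (0 : R).
    rewrite -(mul0r (`|c0| ^+ 3)) -[X in X * _](mulr0 2).
    apply: cvgM; first by apply: cvgM => //; exact: cvg_cst.
    rewrite !exprS expr0 mulr1.
    under eq_fun do rewrite !exprS expr0 mulr1.
    by do !apply: cvgM; exact: cvg_norm.
  apply/norm_cvg0P; apply: (@squeeze_cvgr _ _ _ _ (cst 0)
    (fun n => 2 * e n * `|c n| ^+ 3)) => //; last exact: cvg_cst.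
  move/cvgrPdist_le : ecc => /(_ 2^-1 ltac:(lra)).
  apply: filterS => n; rewrite sub0r normrN => /expR_taylor2 h.
  rewrite normr_ge0/= /r.
  have en := e0 n.
  have -> : (expR (e n * c n) - 1 - e n * c n) / e n ^+ 2 - c n ^+ 2 / 2
    = (expR (e n * c n) - 1 - e n * c n - (e n * c n) ^+ 2 / 2) / e n ^+ 2.
    by field; rewrite gt_eqF.
  rewrite normrM normfV [`|e n ^+ 2|]ger0_norm ?sqr_ge0//.
  rewrite ler_pdivrMr ?exprn_gt0// (le_trans h)// normrM gtr0_norm// exprMn.
  by rewrite le_eqVlt; apply/orP; left; apply/eqP; ring.
have -> : (fun n => (expR (e n * c n) - 1 - e n * c n) / e n ^+ 2)
  = (fun n => r n + c n ^+ 2 / 2) by apply/funext => n; rewrite subrK.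
rewrite -[X in _ --> X]add0r; apply: cvgD => //.
apply: cvgM; last exact: cvg_cst.
by under eq_fun do rewrite expr2; rewrite expr2; exact: cvgM.
Qed.

Definition lse Q l q e : R :=
  ln (\sum_j Q j * expR (e * l j - e ^+ 2 * q j)).

Definition lse_rem Q l q e : R :=
  (lse Q l q e - e * \sum_j Q j * l j) / e ^+ 2.

(** Half the variance of [l] under [Q] minus the mean of [q]: the coefficient of [e ^+ 2] in
    [lse]. *)
Definition lse_lim Q l q : R :=
  2^-1 * \sum_j Q j * (l j - \sum_i Q i * l i) ^+ 2 - \sum_j Q j * q j.

Section Weights.
Variable Q : J -> R.
Hypothesis Q0 : forall j, 0 <= Q j.
Hypothesis Q1 : \sum_j Q j = 1.

Lemma weight_le1 j : Q j <= 1.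
Proof. by rewrite -Q1 (bigD1 j)//= lerDl sumr_ge0. Qed.

(** Jensen's inequality, from the tangent line of [expR] at the mean [M]. *)
Lemma sum_expR_ge (g : J -> R) :
  expR (\sum_j Q j * g j) <= \sum_j Q j * expR (g j).
Proof.
set M := \sum_j _.
apply: (@le_trans _ _ (\sum_j expR M * (Q j + (Q j * g j - Q j * M)))).
  rewrite -mulr_sumr big_split/= sumrB -mulr_suml Q1 mul1r subrr addr0.
  by rewrite mulr1.
apply: ler_sum => j _.
have h : expR M * (1 + (g j - M)) <= expR (g j).
  rewrite -[g j in leRHS](subrK M) expRD mulrC ler_pM2r ?expR_gt0//.
  exact: expR_ge1Dx.
apply: le_trans (ler_wpM2l (Q0 j) h).
by rewrite le_eqVlt; apply/orP; left; apply/eqP; ring.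
Qed.

Lemma sum_expR_gt0 (g : J -> R) : 0 < \sum_j Q j * expR (g j).
Proof. exact: lt_le_trans (expR_gt0 _) (sum_expR_ge g). Qed.

(* If every [c j] is at most 1/2, use the quadratic bound on [expR];
   otherwise the right-hand exponent already dominates every [c j]. *)
Lemma sum_expR_le (c : J -> R) : \sum_j Q j * c j = 0 ->
  \sum_j Q j * expR (c j) <= expR (2 * \sum_j c j ^+ 2).
Proof.
move=> Qc; set B := \sum_j c j ^+ 2.
have cB j : c j ^+ 2 <= B.
  by rewrite /B (bigD1 j)//= lerDl sumr_ge0// => i _; exact: sqr_ge0.
have [/forallP h|] := boolP [forall j, c j <= 2^-1].
  apply: (@le_trans _ _ (1 + 2 * B)); last exact: expR_ge1Dx.
  apply: (@le_trans _ _ (\sum_j (Q j + Q j * c j + 2 * (Q j * c j ^+ 2)))).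
    apply: ler_sum => j _; apply: le_trans (ler_wpM2l (Q0 j) (expR_le_quad (h j))) _.
    by rewrite le_eqVlt; apply/orP; left; apply/eqP; ring.
  rewrite !big_split/= Q1 Qc addr0 lerD2l -mulr_sumr ler_pM2l ?ltr0n//.
  by apply: ler_sum => j _; rewrite ler_piMl ?sqr_ge0 ?weight_le1.
move=> /forallPn[j0]; rewrite -ltNge => hj.
have B4 : 4^-1 <= B by have := cB j0; nra.
apply: (@le_trans _ _ (\sum_j Q j * expR (2 * B))).
  apply: ler_sum => j _; rewrite ler_wpM2l// ler_expR.
  by have := cB j; nra.
by rewrite -mulr_suml Q1 mul1r.
Qed.

(** Jensen's inequality again. With [lse_rem_le] it bounds the remainder uniformly in [e], as
    dominated convergence requires. *)
Lemma lse_rem_ge l q e : 0 < e -> - \sum_j Q j * q j <= lse_rem Q l q e.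
Proof.
move=> e0; rewrite /lse_rem ler_pdivlMr ?exprn_gt0// lerBrDr.
rewrite /lse -ler_expR lnK ?posrE ?sum_expR_gt0//.
apply: le_trans (sum_expR_ge _).
rewrite ler_expR le_eqVlt; apply/orP; left; apply/eqP.
rewrite mulNr mulr_suml mulr_sumr addrC -sumrB; apply: eq_bigr => j _; ring.
Qed.

(** The terms [q j] only lower the sum and are dropped; the exponents [e * (l j - M)] have mean
    zero, so [sum_expR_le] applies. *)
Lemma lse_rem_le l q e : 0 < e -> (forall j, 0 <= q j) ->
  lse_rem Q l q e <= 2 * \sum_j (l j - \sum_i Q i * l i) ^+ 2.
Proof.
move=> e0 q0; set M := \sum_i Q i * l i.
rewrite /lse_rem ler_pdivrMr ?exprn_gt0// lerBlDr -/M.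
rewrite /lse -ler_expR lnK ?posrE ?sum_expR_gt0// expRD.
apply: (@le_trans _ _ (\sum_j Q j * expR (e * (l j - M)) * expR (e * M))).
  apply: ler_sum => j _; rewrite -mulrA -expRD ler_wpM2l// ler_expR.
  by have := q0 j; have := sqr_ge0 e; nra.
rewrite -mulr_suml ler_pM2r ?expR_gt0//.
apply: (le_trans (sum_expR_le _)).
  under eq_bigr do rewrite mulrCA mulrBr.
  by rewrite -mulr_sumr sumrB -mulr_suml Q1 mul1r subrr mulr0.
rewrite ler_expR le_eqVlt; apply/orP; left; apply/eqP.
under eq_bigr do rewrite exprMn.
by rewrite -mulr_sumr; ring.
Qed.

(** After factoring out [expR (e n * M)] the sum is [1 + t n] with [t n] of order [e n ^+ 2], so
    [ln (1 + t n)] may be replaced by [t n]. *)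
Lemma cvg_lse_rem l q (e : R^nat) : (forall n, 0 < e n) ->
  e @ \oo --> (0 : R) -> (fun n => lse_rem Q l q (e n)) @ \oo --> lse_lim Q l q.
Proof.
move=> e0 ec; set M := \sum_i Q i * l i.
pose c j n := l j - M - e n * q j.
have cc j : c j @ \oo --> l j - M.
  rewrite -[X in _ --> X]subr0; apply: cvgB; first exact: cvg_cst.
  by rewrite -(mul0r (q j)); apply: cvgM => //; exact: cvg_cst.
pose t n := \sum_j Q j * (expR (e n * c j n) - 1).
have t1 n : 1 + t n = \sum_j Q j * expR (e n * c j n).
  by rewrite /t; under eq_bigr do rewrite mulrBr mulr1; rewrite sumrB Q1 addrC subrK.
have tgt n : 0 < 1 + t n by rewrite t1 sum_expR_gt0.
have remE n : lse_rem Q l q (e n) = ln (1 + t n) / e n ^+ 2.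
  congr (_ / _); rewrite /lse -/M.
  have -> : \sum_j Q j * expR (e n * l j - e n ^+ 2 * q j)
          = (1 + t n) * expR (e n * M).
    rewrite t1 mulr_suml; apply: eq_bigr => j _; rewrite -mulrA -expRD.
    by congr (_ * expR _); rewrite /c; ring.
  by rewrite lnM ?posrE ?expR_gt0// expRK addrK.
have tE n : t n / e n ^+ 2 =
    \sum_j Q j * ((expR (e n * c j n) - 1 - e n * c j n) / e n ^+ 2)
    - \sum_j Q j * q j.
  have en : e n != 0 by rewrite gt_eqF.
  (* The values [l j - M] average to zero, so the first-order terms [e n * c j n] contribute only
     the mean of [q]. *)
  have -> : \sum_j Q j * q j = - ((\sum_j Q j * (e n * c j n)) / e n ^+ 2).
    have -> : \sum_j Q j * (e n * c j n) = - (e n ^+ 2 * \sum_j Q j * q j).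
      transitivity (e n * (\sum_j Q j * l j - \sum_j Q j * M)
                    - e n ^+ 2 * \sum_j Q j * q j).
        rewrite -sumrB !mulr_sumr -sumrB; apply: eq_bigr => j _.
        by rewrite /c; ring.
      by rewrite -mulr_suml Q1 mul1r subrr mulr0 sub0r.
    by field.
  rewrite opprK /t !mulr_suml -big_split/=; apply: eq_bigr => j _.
  by field.
have tc : (fun n => t n / e n ^+ 2) @ \oo --> lse_lim Q l q.
  under eq_fun do rewrite tE.
  apply: cvgB; last exact: cvg_cst.
  rewrite mulr_sumr; apply: cvg_sumr => j.
  have -> : 2^-1 * (Q j * (l j - M) ^+ 2) = Q j * ((l j - M) ^+ 2 / 2) by ring.
  apply: cvgM; first exact: cvg_cst.
  exact: cvg_expR_second_order.
have t0 : t @ \oo --> (0 : R).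
  have -> : t = (fun n => t n / e n ^+ 2 * (e n * e n)).
    by apply/funext => n; field; rewrite gt_eqF.
  rewrite -(mulr0 (lse_lim Q l q)) -[X in _ * X](mulr0 0).
  by apply: cvgM => //; exact: cvgM.
under eq_fun do rewrite remE.
(* Squeeze by [t / (1 + t) <= ln (1 + t) <= t]; the lower bound is [ln x <= x - 1] at
   [x = (1 + t)^-1]. *)
apply: (@squeeze_cvgr _ _ _ _ (fun n => t n / e n ^+ 2 * (1 + t n)^-1)
  (fun n => t n / e n ^+ 2)) => //.
  near=> n.
  have e2 : 0 < (e n ^+ 2)^-1 by rewrite invr_gt0 exprn_gt0.
  apply/andP; split; last first.
    by rewrite ler_pM2r// le_ln1Dx//; have := tgt n; lra.
  rewrite mulrAC ler_pM2r//.
  have /le_ln1Dx : -1 < (1 + t n)^-1 - 1 by rewrite ltrBrDl subrr invr_gt0.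
  rewrite addrC subrK lnV ?posrE// => h.
  have -> : t n / (1 + t n) = - ((1 + t n)^-1 - 1) by field; rewrite gt_eqF.
  by rewrite lerNl.
rewrite -[X in _ --> X]mulr1; apply: cvgM => //.
rewrite -[X in _ --> X]invr1; apply: cvgV; first exact: oner_neq0.
by rewrite -[X in _ --> X]addr0; apply: cvgD => //; exact: cvg_cst.
Unshelve. all: by end_near.
Qed.

End Weights.
End LogSumExp.

(** * Expectations through densities and independence *)

Section Moments.
Context {d : measure_display} {T : measurableType d} {R : realType}.
Variable P : probability T R.

Local Notation leb := (@lebesgue_measure R).

(** The law of [X] is absolutely continuous, and its Radon-Nikodym derivative has the same integral
    as [g] on every measurable set, hence equals [g] almost everywhere. *)
Lemma ge0_integral_density (X : T -> R) (g phi : R -> R) :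
  measurable_fun setT X -> measurable_fun setT g -> (forall x, 0 <= g x) ->
  measurable_fun setT phi -> (forall x, 0 <= phi x) ->
  (forall A, measurable A -> P (X @^-1` A) = (\int[leb]_(x in A) (g x)%:E)%E) ->
  (\int[P]_t (phi (X t))%:E = \int[leb]_x (phi x * g x)%:E)%E.
Proof.
move=> mX mg g0 mphi phi0 lawX.
have mX' : measurable_fun setT (X : T -> measurableTypeR R) by exact: mX.
pose X' : {RV P >-> measurableTypeR R} :=
  HB.pack (X : T -> measurableTypeR R) (isMeasurableFun.Build _ _ _ _ _ mX').
pose nu : {finite_measure set (measurableTypeR R) -> \bar R} :=
  distribution P X'.
have nuE A : measurable A -> nu A = (\int[leb]_(x in A) (g x)%:E)%E.
  by move=> mA; rewrite -lawX.
have numu : nu `<< leb.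
  apply/null_content_dominatesP => A mA A0; rewrite nuE//.
  apply: null_set_integral => //; apply/measurable_EFinP.
  exact: measurable_funTS.
transitivity (\int[nu]_x (phi x)%:E)%E.
  rewrite /nu /= /distribution ge0_integral_pushforward//=.
  - by apply/measurable_EFinP.
  - by move=> x _; rewrite lee_fin.
have phi0E (x : measurableTypeR R) : (0 <= (phi x)%:E)%E by rewrite lee_fin.
have mphiE : measurable_fun setT (fun x : measurableTypeR R => (phi x)%:E).
  by apply/measurable_EFinP; exact: mphi.
rewrite -(Radon_Nikodym_SigmaFinite.change_of_variables numu phi0E measurableT mphiE).
have mf : measurable_fun setT (Radon_Nikodym_SigmaFinite.f nu leb).
  exact: measurable_int (Radon_Nikodym_SigmaFinite.f_integrable numu).
under [RHS]eq_integral do rewrite EFinM.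
apply: ae_eq_integral => //.
- by apply: emeasurable_funM => //; apply/measurable_EFinP.
- by apply: emeasurable_funM; apply/measurable_EFinP.
- apply: ae_eqe_mul2l; apply: integral_ae_eq => //.
  + exact: Radon_Nikodym_SigmaFinite.f_integrable.
  + by apply/measurable_EFinP.
  + by move=> A _ mA; rewrite -Radon_Nikodym_SigmaFinite.f_integral// nuE.
Qed.

(** Independence on rectangles identifies the joint law with the product of the marginals; Tonelli's
    theorem then separates the integrals. *)
Lemma ge0_integral_indep (X Y : T -> R) (f g : R -> R) :
  measurable_fun setT X -> measurable_fun setT Y ->
  measurable_fun setT f -> measurable_fun setT g ->
  (forall x, 0 <= f x) -> (forall x, 0 <= g x) ->
  (forall A B, measurable A -> measurable B ->
    P (X @^-1` A `&` Y @^-1` B) = (P (X @^-1` A) * P (Y @^-1` B))%E) ->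
  (\int[P]_t (f (X t) * g (Y t))%:E =
   \int[P]_t (f (X t))%:E * \int[P]_t (g (Y t))%:E)%E.
Proof.
move=> mX mY mf mg f0 g0 indep.
pose X' : {RV P >-> R} := HB.pack X (isMeasurableFun.Build _ _ _ _ X mX).
pose Y' : {RV P >-> R} := HB.pack Y (isMeasurableFun.Build _ _ _ _ Y mY).
pose XY t := (X t, Y t).
have mXY : measurable_fun setT XY by exact: measurable_fun_pair.
pose XY' : {mfun T >-> (R * R)%type} :=
  HB.pack XY (isMeasurableFun.Build _ _ _ _ XY mXY).
pose nX := distribution P X'; pose nY := distribution P Y'.
pose nXY := distribution P XY'.
pose F (z : R * R) : \bar R := (f z.1 * g z.2)%:E.
have mF : measurable_fun setT F.
  apply/measurable_EFinP; apply: measurable_funM.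
    exact: measurableT_comp.
  exact: measurableT_comp.
have F0 z : (0 <= F z)%E by rewrite lee_fin mulr_ge0.
transitivity (\int[nXY]_z F z)%E.
  by rewrite /nXY /distribution ge0_integral_pushforward.
transitivity (\int[(nX \x nY)%E]_z F z)%E.
  apply: eq_measure_integral => /= A mA _.
  by apply/esym; apply: (@product_measure_unique _ _ _ _ R nX nY nXY).
rewrite fubini_tonelli1//= /fubini_F.
have gY : (\int[nY]_y (g y)%:E = \int[P]_t (g (Y t))%:E)%E.
  rewrite /nY /distribution ge0_integral_pushforward//=.
  - by apply/measurable_EFinP.
  - by move=> x _; rewrite lee_fin.
have fX : (\int[nX]_y (f y)%:E = \int[P]_t (f (X t))%:E)%E.
  rewrite /nX /distribution ge0_integral_pushforward//=.
  - by apply/measurable_EFinP.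
  - by move=> x _; rewrite lee_fin.
transitivity (\int[nX]_x ((f x)%:E * \int[nY]_y (g y)%:E))%E.
  apply: eq_integral => x _; rewrite -ge0_integralZl//=.
  - by apply/measurable_EFinP.
  - by move=> y _; rewrite lee_fin.
  - by rewrite lee_fin.
rewrite ge0_integralZr// ?fX ?gY//.
- by apply/measurable_EFinP.
- by move=> y _; rewrite lee_fin.
- by apply: integral_ge0 => y _; rewrite lee_fin.
Qed.

(** Half of the exponent absorbs the square, as [x ^+ 2 / 4 <= expR (x ^+ 2 / 4)]; what remains is a
    multiple of the normal density of variance 2. *)
Lemma gauss_second_moment_lty :
  (\int[leb]_x (x ^+ 2 * ((Num.sqrt (2 * pi))^-1 * expR (- x ^+ 2 / 2)))%:E
   < +oo)%E.
Proof.
set K := (Num.sqrt (2 * pi))^-1.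
have K0 : 0 <= K by rewrite invr_ge0 sqrtr_ge0.
have s2 : Num.sqrt 2 != 0 :> R by rewrite gt_eqF// sqrtr_gt0.
pose L := normal_peak (Num.sqrt 2 : R).
have L0 : 0 < L by exact: normal_peak_gt0.
have C0 : 0 <= 4 * K / L by rewrite divr_ge0 ?mulr_ge0// ltW.
pose npdf := @normal_pdf R 0 (Num.sqrt 2).
have mn : measurable_fun setT npdf by exact: measurable_normal_pdf.
apply: (@le_lt_trans _ _ (\int[leb]_x ((4 * K / L)%:E * (npdf x)%:E))%E).
  apply: ge0_le_integral => //=.
  - by move=> x _; rewrite lee_fin mulr_ge0 ?sqr_ge0// mulr_ge0// expR_ge0.
  - apply/measurable_EFinP; apply: measurable_funM; first exact: measurable_funX.
    apply: measurable_funM => //; apply: measurableT_comp => //.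
    by apply: measurable_funM => //; apply: measurableT_comp => //.
  - by apply/measurable_funeM/measurable_EFinP.
  - move=> x _; rewrite -EFinM lee_fin.
    have -> : npdf x = L * expR (- x ^+ 2 / 4).
      rewrite /npdf normal_pdfE//= /normal_fun subr0 sqr_sqrtr//.
      by rewrite -[2 *+ 2]mulr_natr -natrM.
    rewrite [leRHS]mulrA divfK ?gt_eqF//.
    have -> : - x ^+ 2 / 2 = - x ^+ 2 / 4 - x ^+ 2 / 4 :> R by field.
    rewrite expRD.
    have h : x ^+ 2 / 4 * expR (- (x ^+ 2 / 4)) <= 1.
      rewrite expRN ler_pdivrMr ?expR_gt0// mul1r.
      by apply: le_trans (expR_ge1Dx _); rewrite lerDr.
    have E0 : 0 <= K * expR (- x ^+ 2 / 4) by rewrite mulr_ge0// expR_ge0.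
    by have := ler_wpM2l E0 h; rewrite mulr1; nra.
rewrite ge0_integralZl//=.
- by rewrite integral_normal_pdf mule1 ltry.
- by apply/measurable_EFinP.
- by move=> x _; rewrite lee_fin normal_pdf_ge0.
Qed.

End Moments.

(** * Integrable real functions and dominated convergence *)

Section RealIntegrable.
Context {d : measure_display} {T : measurableType d} {R : realType}.
Variable P : probability T R.
Implicit Types f g : T -> R.

Local Notation integrableR f := (P.-integrable setT (EFin \o f)).

Lemma integrableRD f g : integrableR f -> integrableR g ->
  integrableR (fun t => f t + g t).
Proof. by move=> fi gi; exact: (integrableD measurableT fi gi). Qed.

Lemma integrableRZ (c : R) f : integrableR f -> integrableR (fun t => c * f t).
Proof. by move=> fi; exact: (integrableZl measurableT c fi). Qed.

Lemma integrableR_cst (c : R) : integrableR (fun _ => c).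
Proof. exact: finite_measure_integrable_cst. Qed.

Lemma integrableR_sum (I : Type) (r : seq I) (f : I -> T -> R) :
  (forall i, integrableR (f i)) -> integrableR (fun t => \sum_(i <- r) f i t).
Proof.
move=> fi; elim: r => [|i r IH].
  by under eq_fun do rewrite big_nil; exact: integrableR_cst.
under eq_fun do rewrite big_cons; exact: integrableRD.
Qed.

Lemma le_integrableR f g : measurable_fun setT f ->
  (forall t, `|f t| <= g t) -> integrableR g -> integrableR f.
Proof.
move=> mf fg gi; apply: le_integrable gi => //=; first exact/measurable_EFinP.
by move=> t _; rewrite lee_fin (le_trans (fg t))// ler_norm.
Qed.

Lemma Rintegral_lincomb (I : Type) (r : seq I) (c : I -> R) (f : I -> T -> R) :
  (forall i, integrableR (f i)) ->
  Rintegral P setT (fun t => \sum_(i <- r) c i * f i t) =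
  \sum_(i <- r) c i * Rintegral P setT (f i).
Proof.
move=> fi; elim: r => [|i r IH].
  rewrite big_nil; under eq_Rintegral do rewrite big_nil.
  by rewrite Rintegral_cst// mul0r.
rewrite big_cons; under eq_Rintegral do rewrite big_cons.
rewrite RintegralD//; last 2 first.
- exact: integrableRZ.
- by apply: integrableR_sum => j; exact: integrableRZ.
by rewrite IH RintegralZl.
Qed.

Lemma cvg_Rintegral_dominated (f_ : nat -> T -> R) f g :
  (forall n, measurable_fun setT (f_ n)) -> integrableR g ->
  (forall n t, `|f_ n t| <= g t) ->
  (forall t, f_ ^~ t @ \oo --> f t) ->
  integrableR f /\
  (fun n => Rintegral P setT (f_ n)) @ \oo --> Rintegral P setT f.
Proof.
move=> mf_ gi fg ff.
have mf : measurable_fun setT f.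
  by apply: (measurable_fun_cvg mf_) => t _; exact: ff.
have [] := @dominated_convergence _ _ _ P setT measurableT
  (fun n => EFin \o f_ n) (EFin \o f) (EFin \o g).
- by move=> n; exact/measurable_EFinP.
- exact/measurable_EFinP.
- by apply: aeW => t _; apply: cvg_EFin; [exact: nearW|exact: ff].
- by [].
- by apply: aeW => t n _; rewrite lee_fin.
move=> fi _ cv; split => //.
by apply: fine_cvg; rewrite fineK//; exact: integrable_fin_num.
Qed.

End RealIntegrable.

(** * Second moments of fading and noise *)

Section ChannelMoments.
Context {d : measure_display} {T : measurableType d} {R : realType} {N : nat}.
Variables (P : probability T R) (H Z : 'I_N -> T -> R) (pH : R -> R).
Hypothesis hch : channel_model P H Z pH.

Let mH j : measurable_fun setT (H j). Proof. by case: hch. Qed.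
Let mZ j : measurable_fun setT (Z j). Proof. by case: hch => _ []. Qed.

Let measurable_sqr : measurable_fun setT (fun x : R => x ^+ 2).
Proof. exact: measurable_funX. Qed.

(** The product rule is applied with the whole line at every coordinate other than [j]. *)
Lemma channel_indep j (A B : set R) : measurable A -> measurable B ->
  P (H j @^-1` A `&` Z j @^-1` B) = (P (H j @^-1` A) * P (Z j @^-1` B))%E.
Proof.
move=> mA mB; case: hch => _ [_ [_ [_ [_ [_ [ind _]]]]]].
pose A' (i : 'I_N) : set R := if i == j then A else setT.
pose B' (i : 'I_N) : set R := if i == j then B else setT.
have mA' i : measurable (A' i) by rewrite /A'; case: ifP.
have mB' i : measurable (B' i) by rewrite /B'; case: ifP.
have := ind B' A' mB' mA'.
have -> : [set t | forall i, B' i (Z i t) /\ A' i (H i t)]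
        = H j @^-1` A `&` Z j @^-1` B.
  apply/seteqP; split => [t /(_ j)|t [At Bt] i]; rewrite /A' /B'.
    by rewrite eqxx => -[].
  by case: eqP => [->|].
have -> : [set t | forall i, A' i (H i t)] = H j @^-1` A.
  apply/seteqP; split => [t /(_ j)|t At i]; rewrite /A'.
    by rewrite eqxx.
  by case: eqP => [->|].
rewrite (bigD1 j)//= big1 ?mule1; last first.
  by move=> i /negbTE ij; rewrite /B' ij preimage_setT probability_setT.
by rewrite /B' eqxx muleC.
Qed.

Lemma channel_H2_lty j : (\int[P]_t (H j t ^+ 2)%:E < +oo)%E.
Proof.
case: hch => _ [_ [mp [p0 [lawH [_ [_ fin]]]]]].
rewrite (ge0_integral_density (mH j) mp p0 measurable_sqr _ (lawH j))// => x.
exact: sqr_ge0.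
Qed.

Lemma channel_Z2_lty j : (\int[P]_t (Z j t ^+ 2)%:E < +oo)%E.
Proof.
case: hch => _ [_ [_ [_ [_ [lawZ _]]]]].
rewrite (ge0_integral_density (mZ j) _ _ measurable_sqr _ (lawZ j))//.
- exact: gauss_second_moment_lty.
- apply: measurable_funM => //; apply: measurableT_comp => //.
  by apply: measurable_funM => //; apply: measurableT_comp.
- by move=> x; exact: sqr_ge0.
Qed.

Lemma channel_integrable_H2 j : P.-integrable setT (EFin \o (fun t => H j t ^+ 2)).
Proof.
apply/integrableP; split; first by apply/measurable_EFinP; exact: measurable_funX.
under eq_integral do rewrite /= ger0_norm ?sqr_ge0//.
exact: channel_H2_lty.
Qed.

Lemma channel_integrable_H2Z2 j :
  P.-integrable setT (EFin \o (fun t => (H j t * Z j t) ^+ 2)).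
Proof.
apply/integrableP; split.
  by apply/measurable_EFinP; apply: measurable_funX; exact: measurable_funM.
under eq_integral do rewrite /= ger0_norm ?sqr_ge0// exprMn.
rewrite (ge0_integral_indep (X := H j) (Y := Z j)
  (f := fun x => x ^+ 2) (g := fun x => x ^+ 2))//; last 3 first.
- by move=> x; exact: sqr_ge0.
- by move=> x; exact: sqr_ge0.
- exact: channel_indep.
rewrite lte_mul_pinfty ?channel_H2_lty ?channel_Z2_lty//.
  by apply: integral_ge0 => t _; rewrite lee_fin sqr_ge0.
rewrite ge0_fin_numE ?channel_H2_lty//.
by apply: integral_ge0 => t _; rewrite lee_fin sqr_ge0.
Qed.

(** Different fading coordinates may be dependent, so the mixed product is bounded by the sum of the
    two squares. *)
Lemma channel_integrable_HZHZ i j :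
  P.-integrable setT (EFin \o (fun t => H i t * Z i t * (H j t * Z j t))).
Proof.
apply: (le_integrableR (g := fun t => (H i t * Z i t) ^+ 2 + (H j t * Z j t) ^+ 2)).
- by apply: measurable_funM; exact: measurable_funM.
- move=> t; set a := H i t * _; set b := H j t * _.
  have := sqr_ge0 (a + b); have := sqr_ge0 (a - b).
  have := sqr_ge0 a; have := sqr_ge0 b.
  by rewrite ler_norml; nra.
- by apply: integrableRD; exact: channel_integrable_H2Z2.
Qed.

Lemma channel_integrable_HZ j : P.-integrable setT (EFin \o (fun t => H j t * Z j t)).
Proof.
apply: (le_integrableR (g := fun t => 1 + (H j t * Z j t) ^+ 2)).
- exact: measurable_funM.
- by move=> t; rewrite ler_norml; nra.
- by apply: integrableRD; [exact: integrableR_cst|exact: channel_integrable_H2Z2].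
Qed.

End ChannelMoments.

(** * Gaussian likelihoods as exponential tilts *)

Section Tilt.
Context {R : realType} {m N : nat}.
Implicit Types (X : 'M[R]_(2 ^ m, N)) (s h z : 'I_N -> R).

(* With [s d = h d * z d], the log-likelihood of symbol [j] when [i] is sent is
   [e * tilt_lin X i s j - e ^+ 2 * tilt_quad X i h j] up to a term free of
   [j], where [e = N0 ^ (-1/2)]. *)
Definition tilt_lin X (i : 'I_(2 ^ m)) s (j : 'I_(2 ^ m)) : R :=
  Num.sqrt 2 * \sum_d s d * (X j d - X i d).

Definition tilt_quad X (i : 'I_(2 ^ m)) h (j : 'I_(2 ^ m)) : R :=
  \sum_d h d ^+ 2 * (X i d - X j d) ^+ 2.

Lemma tilt_quad_ge0 X i h j : 0 <= tilt_quad X i h j.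
Proof. by apply: sumr_ge0 => d _; rewrite mulr_ge0 ?sqr_ge0. Qed.

(** Expand the square of signal difference plus noise: the pure noise term gives the prefactor free
    of [j], the cross term the linear tilt, and the signal term the quadratic one. *)
Lemma gauss_tilt X i j (e : R) h z : 0 < e ->
  gauss (e ^- 2) (fun d => h d * X i d + Num.sqrt (e ^- 2 / 2) * z d)
    (fun d => h d * X j d) =
  \prod_(d < N) ((Num.sqrt (pi * e ^- 2))^-1 * expR (- z d ^+ 2 / 2)) *
  expR (e * tilt_lin X i (fun d => h d * z d) j - e ^+ 2 * tilt_quad X i h j).
Proof.
move=> e0; have en0 : e != 0 by rewrite gt_eqF.
have w2 : Num.sqrt 2 ^+ 2 = 2 :> R by rewrite sqr_sqrtr.
have -> : Num.sqrt (e ^- 2 / 2) = Num.sqrt 2 / (2 * e).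
  have -> : e ^- 2 / 2 = (Num.sqrt 2 / (2 * e)) ^+ 2.
    by rewrite exprMn w2; field.
  by rewrite sqrtr_sqr ger0_norm// divr_ge0 ?sqrtr_ge0// mulr_ge0// ltW.
rewrite /tilt_lin /tilt_quad !mulr_sumr -sumrB expR_sum -big_split/=.
apply: eq_bigr => d _; rewrite -[RHS]mulrA -expRD; congr (_ * expR _).
set w := Num.sqrt 2 in w2 *.
have -> : - (h d * X i d + w / (2 * e) * z d - h d * X j d) ^+ 2 / e ^- 2 =
  - (e ^+ 2 * (h d ^+ 2 * (X i d - X j d) ^+ 2))
  - e * w * (h d * z d * (X i d - X j d)) - w ^+ 2 * z d ^+ 2 / 4 by field.
by rewrite w2; field.
Qed.

Section Averages.
Variables (X : 'M[R]_(2 ^ m, N)) (Q : 'I_(2 ^ m) -> R).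
Hypothesis Q1 : \sum_j Q j = 1.

Let E d := \sum_j Q j * X j d.

Lemma tilt_lin_mean i s :
  \sum_j Q j * tilt_lin X i s j = Num.sqrt 2 * \sum_d s d * (E d - X i d).
Proof.
under eq_bigr do rewrite mulrCA.
rewrite -mulr_sumr; congr (_ * _).
under eq_bigr do rewrite mulr_sumr.
rewrite exchange_big/=; apply: eq_bigr => d _.
under eq_bigr do rewrite mulrCA mulrBr.
by rewrite -mulr_sumr sumrB -mulr_suml Q1 mul1r.
Qed.

(** The sent symbol [i] shifts all values of [tilt_lin] equally, so centring removes it. *)
Lemma tilt_lin_centered i s j :
  tilt_lin X i s j - \sum_l Q l * tilt_lin X i s l =
  Num.sqrt 2 * \sum_d s d * (X j d - E d).
Proof.
rewrite tilt_lin_mean /tilt_lin -mulrBr -sumrB; congr (_ * _).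
by apply: eq_bigr => d _; ring.
Qed.

Lemma sqr_tilt_lin_centered i s j :
  (tilt_lin X i s j - \sum_l Q l * tilt_lin X i s l) ^+ 2 =
  \sum_d \sum_f 2 * ((X j d - E d) * (X j f - E f)) * (s d * s f).
Proof.
rewrite tilt_lin_centered exprMn sqr_sqrtr// expr2 mulr_suml mulr_sumr.
apply: eq_bigr => d _; rewrite !mulr_sumr; apply: eq_bigr => f _; ring.
Qed.

Lemma lse_lim_tilt i s h :
  lse_lim Q (tilt_lin X i s) (tilt_quad X i h) =
  \sum_d \sum_f s d * s f * (\sum_j Q j * (X j d * X j f) - E d * E f) -
  \sum_d h d ^+ 2 *
    (X i d ^+ 2 - 2 * X i d * E d + \sum_j Q j * (X j d * X j d)).
Proof.
rewrite /lse_lim; congr (_ - _).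
  under eq_bigr do rewrite sqr_tilt_lin_centered mulr_sumr.
  rewrite exchange_big mulr_sumr/=; apply: eq_bigr => d _.
  under eq_bigr do rewrite mulr_sumr.
  rewrite exchange_big mulr_sumr/=; apply: eq_bigr => f _.
  (* The centres are generalised to arbitrary [a] and [b], so that expanding by linearity leaves the
     averages [E d] and [E f] folded. *)
  have expand (a b : R) :
      2^-1 * (\sum_j Q j * (2 * ((X j d - a) * (X j f - b)) * (s d * s f))) =
      s d * s f * (\sum_j Q j * (X j d * X j f) - a * (\sum_j Q j * X j f)
        - b * (\sum_j Q j * X j d) + a * b * \sum_j Q j).
    rewrite [a * (\sum_j _)]mulr_sumr [b * (\sum_j _)]mulr_sumr.
    rewrite [a * b * _]mulr_sumr -!sumrB -big_split/=.
    by rewrite !mulr_sumr; apply: eq_bigr => j _; field.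
  by rewrite expand Q1 -!/(E _); ring.
rewrite /tilt_quad; under eq_bigr do rewrite mulr_sumr.
rewrite exchange_big/=; apply: eq_bigr => d _.
transitivity (h d ^+ 2 * (X i d ^+ 2 * (\sum_j Q j)
  - 2 * X i d * (\sum_j Q j * X j d) + \sum_j Q j * (X j d * X j d))).
  rewrite !mulr_sumr -sumrB -big_split/= mulr_sumr.
  by apply: eq_bigr => j _; ring.
by rewrite Q1 mulr1.
Qed.

End Averages.
End Tilt.

(** * Conditional symbol laws and the averaged second-order term *)

Section BitWeights.
Context {R : realType} {m N : nat}.
Variable (p : 'I_m -> R).
Hypothesis hp : forall k, 0 < p k < 1.

(** The conditional law of the symbol given [C_k = u], extended by zero to a weight on all symbols,
    as [lse] expects. *)
Definition bit_weight (k : 'I_m) (u : bool) (j : 'I_(2 ^ m)) : R :=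
  if bit j k == u then Psym p j / Pbit p k u else 0.

Lemma bit_weight_ge0 k u j : 0 <= bit_weight k u j.
Proof.
rewrite /bit_weight; case: ifP => // _.
by rewrite divr_ge0// ltW// ?Psym_gt0// Pbit_gt0.
Qed.

Lemma sum_bit_weight k u : \sum_j bit_weight k u j = 1.
Proof.
pose f b : R := if b == u then (Pbit p k u)^-1 else 0.
transitivity (\sum_(j < 2 ^ m) Psym p j * f (bit j k)).
  by apply: eq_bigr => j _; rewrite /bit_weight /f; case: ifP; rewrite ?mulr0.
rewrite sum_Psym_bit /f {f}.
have := Pbit_gt0 true (hp k); have := Pbit_gt0 false (hp k).
by rewrite /Pbit; case: u => /= h0 h1; rewrite ?mulr0 ?add0r ?addr0 divff// gt_eqF.
Qed.

Lemma cond_mean_bit_weight (X : 'M[R]_(2 ^ m, N)) k u d :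
  \sum_j bit_weight k u j * X j d = cond_mean p X k u d.
Proof.
rewrite /cond_mean [RHS]big_mkcond/=; apply: eq_bigr => j _.
by rewrite /bit_weight; case: ifP; rewrite ?mul0r.
Qed.

(** Tower property of conditional expectation; [g] passes inside because it depends on the
    conditioning bit alone. *)
Lemma tower_bit_weight (k : 'I_m) (F : 'I_(2 ^ m) -> R) (g : bool -> R) :
  \sum_(i < 2 ^ m) Psym p i * (g (bit i k) * \sum_j bit_weight k (bit i k) j * F j) =
  \sum_(j < 2 ^ m) Psym p j * (g (bit j k) * F j).
Proof.
rewrite (sum_Psym_bit p k (fun b => g b * \sum_j bit_weight k b j * F j)).
rewrite [RHS](bigID (fun j : 'I_(2 ^ m) => bit j k == false))/=.
have := Pbit_gt0 true (hp k); have := Pbit_gt0 false (hp k).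
rewrite /Pbit/= => h0 h1; congr (_ + _).
  rewrite [RHS]big_mkcond !mulr_sumr/=; apply: eq_bigr => j _.
  rewrite /bit_weight /Pbit; case: eqP => [->|_]; last by rewrite !(mul0r, mulr0).
  by field; rewrite gt_eqF.
rewrite [RHS]big_mkcond !mulr_sumr/=; apply: eq_bigr => j _.
rewrite /bit_weight /Pbit; case: bit => /=; last by rewrite !(mul0r, mulr0).
by field; rewrite gt_eqF.
Qed.

Lemma bit_cov_raw (X : 'M[R]_(2 ^ m, N)) k d f :
  bit_cov p X k d f =
  \sum_(i < 2 ^ m) Psym p i *
    (cond_mean p X k (bit i k) d * cond_mean p X k (bit i k) f)
  - mean p X 0 d * mean p X 0 f.
Proof.
have Ed := sum_cond_mean X d (hp k); have Ef := sum_cond_mean X f (hp k).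
rewrite /bit_cov; set M := mean p X 0 d in Ed *; set M' := mean p X 0 f in Ef *.
transitivity (\sum_(i < 2 ^ m) Psym p i *
    (cond_mean p X k (bit i k) d * cond_mean p X k (bit i k) f)
  - M' * (\sum_(i < 2 ^ m) Psym p i * cond_mean p X k (bit i k) d)
  - M * (\sum_(i < 2 ^ m) Psym p i * cond_mean p X k (bit i k) f)
  + M * M' * \sum_(i < 2 ^ m) Psym p i).
  rewrite !mulr_sumr -!sumrB -big_split/=; apply: eq_bigr => i _; ring.
by rewrite Ed Ef sum_Psym; ring.
Qed.

(** Pointwise second-order coefficient of the information on bit [k], in nats. The constellation
    enters only through [bit_cov], so the integral over fading and noise never has to be
    evaluated. *)
Definition low_snr_integrand (X : 'M[R]_(2 ^ m, N)) k (s h : 'I_N -> R) : R :=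
  2 * (\sum_d h d ^+ 2 * bit_cov p X k d d) -
  \sum_d \sum_f s d * s f * bit_cov p X k d f.

(** By the law of total covariance, conditional minus total covariance averages to [- bit_cov]. The
    cross terms of the squared distances average to [- 2 * bit_cov] and enter with a minus sign. *)
Lemma sum_lse_lim (X : 'M[R]_(2 ^ m, N)) (k : 'I_m) s h :
  \sum_(i < 2 ^ m) Psym p i *
    (lse_lim (bit_weight k (bit i k)) (tilt_lin X i s) (tilt_quad X i h)
   - lse_lim (fun j : 'I_(2 ^ m) => Psym p j) (tilt_lin X i s) (tilt_quad X i h))
  = low_snr_integrand X k s h.
Proof.
pose C i d := cond_mean p X k (bit i k) d.
pose M d := mean p X 0 d.
pose A2 i d f := \sum_j bit_weight k (bit i k) j * (X j d * X j f).
pose M2 d f := \sum_(j < 2 ^ m) Psym p j * (X j d * X j f).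
have tower2 d f : \sum_(i < 2 ^ m) Psym p i * A2 i d f = M2 d f.
  have := tower_bit_weight k (fun j => X j d * X j f) (fun=> 1).
  by under eq_bigr do rewrite mul1r; under [in RHS]eq_bigr do rewrite mul1r.
(* [a] and [b] collect the coefficients of [s d * s f] and [- h d ^+ 2]; the term [X i d ^+ 2]
   common to both limits cancels. *)
pose a (i : 'I_(2 ^ m)) d f := (A2 i d f - C i d * C i f) - (M2 d f - M d * M f).
pose b (i : 'I_(2 ^ m)) d := - 2 * X i d * (C i d - M d) + A2 i d d - M2 d d.
have sa d f : \sum_(i < 2 ^ m) Psym p i * a i d f = - bit_cov p X k d f.
  rewrite bit_cov_raw -/(M d) -/(M f).
  transitivity (\sum_(i < 2 ^ m) Psym p i * A2 i d f
    - \sum_(i < 2 ^ m) Psym p i * (C i d * C i f)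
    - (M2 d f - M d * M f) * \sum_(i < 2 ^ m) Psym p i).
    rewrite mulr_sumr -!sumrB; apply: eq_bigr => i _; rewrite /a; ring.
  by rewrite tower2 sum_Psym /C; ring.
have sb d : \sum_(i < 2 ^ m) Psym p i * b i d = - 2 * bit_cov p X k d d.
  rewrite bit_cov_raw -/(M d).
  (* Tower property with [g] the conditional mean itself: one factor [C i d] is exchanged for
     [X i d]. *)
  have CX : \sum_(i < 2 ^ m) Psym p i * (C i d * C i d) =
            \sum_(i < 2 ^ m) Psym p i * (C i d * X i d).
    rewrite -(tower_bit_weight k (fun j => X j d) (fun u => cond_mean p X k u d)).
    by apply: eq_bigr => i _; rewrite cond_mean_bit_weight.
  have MX : M d = \sum_(i < 2 ^ m) Psym p i * X i d by rewrite /M mxE.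
  transitivity (- 2 * (\sum_(i < 2 ^ m) Psym p i * (C i d * X i d)
      - M d * \sum_(i < 2 ^ m) Psym p i * X i d)
    + \sum_(i < 2 ^ m) Psym p i * A2 i d d
    - M2 d d * \sum_(i < 2 ^ m) Psym p i).
    rewrite !mulr_sumr -!sumrB mulr_sumr -big_split/= -sumrB.
    by apply: eq_bigr => i _; rewrite /b; ring.
  by rewrite tower2 sum_Psym -CX -MX /C; ring.
transitivity (\sum_(i < 2 ^ m) Psym p i *
   (\sum_d \sum_f s d * s f * a i d f - \sum_d h d ^+ 2 * b i d)).
  apply: eq_bigr => i _; congr (_ * _).
  rewrite !lse_lim_tilt ?sum_bit_weight ?sum_Psym//.
  have regroup (x y x' y' : R) : x - y - (x' - y') = (x - x') - (y - y') by ring.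
  rewrite regroup; congr (_ - _).
    rewrite -sumrB; apply: eq_bigr => d _; rewrite -sumrB; apply: eq_bigr => f _.
    by rewrite !cond_mean_bit_weight /a /C /M !mxE -mulrBr.
  rewrite -sumrB; apply: eq_bigr => d _.
  by rewrite !cond_mean_bit_weight /b /C /M !mxE -/(A2 i d d) -/(M2 d d); ring.
rewrite /low_snr_integrand.
transitivity (\sum_d \sum_f s d * s f * (\sum_(i < 2 ^ m) Psym p i * a i d f)
   - \sum_d h d ^+ 2 * (\sum_(i < 2 ^ m) Psym p i * b i d)).
  under eq_bigr do rewrite mulrBr.
  rewrite sumrB; congr (_ - _).
    under eq_bigr do rewrite mulr_sumr.
    rewrite exchange_big/=; apply: eq_bigr => d _.
    under eq_bigr do rewrite mulr_sumr.
    rewrite exchange_big/=; apply: eq_bigr => f _.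
    by rewrite mulr_sumr; apply: eq_bigr => i _; ring.
  under eq_bigr do rewrite mulr_sumr.
  rewrite exchange_big/=; apply: eq_bigr => d _.
  by rewrite mulr_sumr; apply: eq_bigr => i _; ring.
rewrite addrC; congr (_ + _).
  rewrite mulr_sumr -sumrN; apply: eq_bigr => d _; rewrite sb; ring.
rewrite -sumrN; apply: eq_bigr => d _; rewrite -sumrN; apply: eq_bigr => f _.
by rewrite sa; ring.
Qed.

End BitWeights.
(** The value of alpha in the nondegenerate case: [ln 2] converts nats to bits, and
    [EH2 pH * energy p X] is the ratio of SNR to [1 / N0]. *)
Definition low_snr_slope (d0 : measure_display) (T : measurableType d0)
    (R : realType) (m N : nat) (P : probability T R) (H Z : 'I_N -> T -> R)
    (pH : R -> R) (p : 'I_m -> R) (X : 'M[R]_(2 ^ m, N)) : R :=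
  \sum_(k < m) Rintegral P setT (fun t =>
    low_snr_integrand p X k (fun d => H d t * Z d t) (fun d => H d t))
      / ln 2 / (EH2 pH * energy p X).

(** * Low-SNR limit of the GMI by dominated convergence *)

Section LowSNR.
Context {d0 : measure_display} {T : measurableType d0} {R : realType} {m N : nat}.
Variables (P : probability T R) (H Z : 'I_N -> T -> R) (pH : R -> R).
Hypothesis hch : channel_model P H Z pH.
Variables (p : 'I_m -> R) (X : 'M[R]_(2 ^ m, N)).
Hypothesis hp : forall k, 0 < p k < 1.

Local Notation integrableR f := (P.-integrable setT (EFin \o f)).

Let mH j : measurable_fun setT (H j). Proof. by case: hch. Qed.
Let mZ j : measurable_fun setT (Z j). Proof. by case: hch => _ []. Qed.

Let h t : 'I_N -> R := fun d => H d t.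
Let s t : 'I_N -> R := fun d => H d t * Z d t.
Let Psy (j : 'I_(2 ^ m)) : R := Psym p j.

Let Psy_ge0 j : 0 <= Psy j. Proof. by rewrite ltW// Psym_gt0. Qed.
Let sum_Psy : \sum_j Psy j = 1. Proof. exact: sum_Psym. Qed.

Lemma measurable_tilt_lin i j : measurable_fun setT (fun t => tilt_lin X i (s t) j).
Proof.
apply: measurable_funM => //; apply: measurable_sum => d.
by apply: measurable_funM => //; exact: measurable_funM.
Qed.

Lemma measurable_tilt_quad i j : measurable_fun setT (fun t => tilt_quad X i (h t) j).
Proof.
by apply: measurable_sum => d; apply: measurable_funM => //; exact: (measurable_funX _ (mH d)).
Qed.

Lemma measurable_lse_rem (Q : 'I_(2 ^ m) -> R) i e :
  measurable_fun setT (fun t => lse_rem Q (tilt_lin X i (s t)) (tilt_quad X i (h t)) e).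
Proof.
have mtl := measurable_tilt_lin i; have mtq := measurable_tilt_quad i.
apply: measurable_funM => //; apply: measurable_funB.
  apply: measurableT_comp; first exact: measurable_ln.
  apply: measurable_sum => j; apply: measurable_funM => //.
  apply: measurableT_comp => //; apply: measurable_funB; exact: measurable_funM.
apply: measurable_funM => //; apply: measurable_sum => j.
exact: measurable_funM.
Qed.

(** The bounds of [lse_rem_ge] and [lse_rem_le] added in absolute value; free of [e], hence a
    dominating function. *)
Let dom (Q : 'I_(2 ^ m) -> R) i t : R :=
  \sum_j Q j * tilt_quad X i (h t) j +
  2 * \sum_j (tilt_lin X i (s t) j - \sum_l Q l * tilt_lin X i (s t) l) ^+ 2.

Let integrable_dom Q i : \sum_j Q j = 1 -> integrableR (dom Q i).
Proof.
move=> Q1; apply: integrableRD.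
  apply: integrableR_sum => j; apply: integrableRZ.
  apply: integrableR_sum => d.
  under eq_fun do rewrite mulrC.
  by apply: integrableRZ; exact: channel_integrable_H2 hch _.
apply: integrableRZ; apply: integrableR_sum => j.
under eq_fun do rewrite sqr_tilt_lin_centered//.
apply: integrableR_sum => d; apply: integrableR_sum => f; apply: integrableRZ.
exact: channel_integrable_HZHZ hch _ _.
Qed.

Let norm_lse_rem_le Q i e t : (forall j, 0 <= Q j) -> \sum_j Q j = 1 -> 0 < e ->
  `|lse_rem Q (tilt_lin X i (s t)) (tilt_quad X i (h t)) e| <= dom Q i t.
Proof.
move=> Q0 Q1 e0; rewrite ler_norml /dom.
have q0 := tilt_quad_ge0 X i (h t).
have := lse_rem_ge Q0 Q1 (tilt_lin X i (s t)) (tilt_quad X i (h t)) e0.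
have := lse_rem_le Q0 Q1 (tilt_lin X i (s t)) e0 q0.
set A := \sum_j Q j * tilt_quad X i (h t) j; set B := \sum_j _ ^+ 2.
have : 0 <= A by apply: sumr_ge0 => j _; rewrite mulr_ge0.
have : 0 <= B by apply: sumr_ge0 => j _; exact: sqr_ge0.
by move=> *; apply/andP; split; lra.
Qed.

(** The factor [G], made of normalisation and pure noise, is common to all symbols and cancels in
    the quotient. *)
Lemma log2_likelihood_ratio k u i e t : 0 < e ->
  log2 (cond_dens p X (e ^- 2) k u (h t)
          (fun d => h t d * X i d + Num.sqrt (e ^- 2 / 2) * Z d t) /
        out_dens p X (e ^- 2) (h t)
          (fun d => h t d * X i d + Num.sqrt (e ^- 2 / 2) * Z d t)) =
  (lse (bit_weight p k u) (tilt_lin X i (s t)) (tilt_quad X i (h t)) e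
   - lse Psy (tilt_lin X i (s t)) (tilt_quad X i (h t)) e) / ln 2.
Proof.
move=> e0; rewrite /log2; congr (_ / _).
set y := fun d => _.
pose G := \prod_(d < N) ((Num.sqrt (pi * e ^- 2))^-1 * expR (- Z d t ^+ 2 / 2)).
pose E j := expR (e * tilt_lin X i (s t) j - e ^+ 2 * tilt_quad X i (h t) j).
have G0 : 0 < G.
  apply: prodr_gt0 => d _; rewrite mulr_gt0 ?expR_gt0// invr_gt0 sqrtr_gt0.
  by rewrite mulr_gt0 ?pi_gt0// invr_gt0 exprn_gt0.
have gE j : gauss (e ^- 2) y (fun d => h t d * X j d) = G * E j.
  exact: (gauss_tilt X i j (h t) (Z ^~ t) e0).
have -> : cond_dens p X (e ^- 2) k u (h t) y = G * \sum_j bit_weight p k u j * E j.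
  rewrite /cond_dens big_mkcond mulr_sumr/=; apply: eq_bigr => j _.
  rewrite /bit_weight; case: ifP => _; last by rewrite mul0r mulr0.
  by rewrite gE mulrCA.
have -> : out_dens p X (e ^- 2) (h t) y = G * \sum_j Psy j * E j.
  by rewrite /out_dens mulr_sumr; apply: eq_bigr => j _; rewrite gE mulrCA.
rewrite -mulf_div divff ?gt_eqF// mul1r ln_div//.
- by rewrite posrE; apply: sum_expR_gt0; [exact: bit_weight_ge0|exact: sum_bit_weight].
- by rewrite posrE; exact: sum_expR_gt0.
Qed.

Let lin_coef (k : 'I_m) (i : 'I_(2 ^ m)) d : R :=
  Num.sqrt 2 * (cond_mean p X k (bit i k) d - mean p X 0 d).
Let drift k i t : R := \sum_d lin_coef k i d * s t d.

Let driftE k (i : 'I_(2 ^ m)) t :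
  \sum_j bit_weight p k (bit i k) j * tilt_lin X i (s t) j
  - \sum_j Psy j * tilt_lin X i (s t) j = drift k i t.
Proof.
rewrite !tilt_lin_mean ?sum_bit_weight// -mulrBr -sumrB mulr_sumr.
apply: eq_bigr => d _; rewrite cond_mean_bit_weight /lin_coef mxE /Psy; ring.
Qed.

Let integrable_drift k i : integrableR (drift k i).
Proof.
apply: integrableR_sum => d; apply: integrableRZ.
exact: channel_integrable_HZ hch _.
Qed.

(* The first-order terms average out over the transmitted symbol, because
   the conditional means average to the mean. *)
Let sum_drift k : \sum_(i < 2 ^ m) Psym p i * Rintegral P setT (drift k i) = 0.
Proof.
rewrite -(Rintegral_lincomb _ (fun i : 'I_(2 ^ m) => Psym p i)); last first.
  by move=> i; exact: integrable_drift.
rewrite (eq_Rintegral _ (g := fun=> 0)) ?Rintegral_cst ?mul0r// => t _.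
rewrite /drift; under eq_bigr do rewrite mulr_sumr.
rewrite exchange_big/= big1// => d _.
transitivity (Num.sqrt 2 * s t d *
  (\sum_(i < 2 ^ m) Psym p i * cond_mean p X k (bit i k) d
   - mean p X 0 d * \sum_(i < 2 ^ m) Psym p i)).
  rewrite [mean p X 0 d * _]mulr_sumr -sumrB mulr_sumr.
  by apply: eq_bigr => i _; rewrite /lin_coef; ring.
by rewrite (sum_cond_mean X d (hp k)) sum_Psym mulr1 subrr mulr0.
Qed.

Let rem_diff k (i : 'I_(2 ^ m)) e t : R :=
  lse_rem (bit_weight p k (bit i k)) (tilt_lin X i (s t)) (tilt_quad X i (h t)) e
  - lse_rem Psy (tilt_lin X i (s t)) (tilt_quad X i (h t)) e.

Let measurable_rem_diff k i e : measurable_fun setT (rem_diff k i e).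
Proof. by apply: measurable_funB; exact: measurable_lse_rem. Qed.

Let rem_diff_le k i e t : 0 < e ->
  `|rem_diff k i e t| <= dom (bit_weight p k (bit i k)) i t + dom Psy i t.
Proof.
move=> e0; rewrite (le_trans (ler_normB _ _))// lerD// norm_lse_rem_le//.
- exact: bit_weight_ge0.
- exact: sum_bit_weight.
Qed.

Let integrable_dom_diff k (i : 'I_(2 ^ m)) :
  integrableR (fun t => dom (bit_weight p k (bit i k)) i t + dom Psy i t).
Proof.
by apply: integrableRD; apply: integrable_dom => //; exact: sum_bit_weight.
Qed.

(** In nats the log-likelihood ratio is [e * drift + e ^+ 2 * rem_diff]; the averaged drift vanishes
    by [sum_drift]. *)
Lemma bit_MI_rem k e : 0 < e ->
  bit_MI P H Z p X (e ^- 2) k / e ^+ 2 =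
  (\sum_(i < 2 ^ m) Psym p i * Rintegral P setT (rem_diff k i e)) / ln 2.
Proof.
move=> e0; have en0 : e != 0 by rewrite gt_eqF.
have ir i : integrableR (rem_diff k i e).
  apply: (le_integrableR _ _ (integrable_dom_diff k i)) => // t.
  exact: rem_diff_le.
have L (i : 'I_(2 ^ m)) : Rintegral P setT (fun t => log2
    (cond_dens p X (e ^- 2) k (bit i k) (h t)
       (fun d => h t d * X i d + Num.sqrt (e ^- 2 / 2) * Z d t) /
     out_dens p X (e ^- 2) (h t)
       (fun d => h t d * X i d + Num.sqrt (e ^- 2 / 2) * Z d t))) =
    e ^+ 2 / ln 2 * Rintegral P setT (rem_diff k i e)
    + e / ln 2 * Rintegral P setT (drift k i).
  rewrite -(RintegralZl _ _ (ir i))// -(RintegralZl _ _ (integrable_drift k i))//.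
  rewrite -RintegralD//; last 2 first.
  - exact: integrableRZ.
  - by apply: integrableRZ; exact: integrable_drift.
  apply: eq_Rintegral => t _; rewrite log2_likelihood_ratio// -driftE.
  rewrite /rem_diff /lse_rem.
  have l2 : ln 2 != 0 :> R by rewrite gt_eqF// ln_gt0// ltr1n.
  by field; rewrite l2.
rewrite /bit_MI; under eq_bigr do rewrite L mulrDr.
rewrite big_split/=.
have -> : \sum_(i < 2 ^ m) Psym p i * (e / ln 2 * Rintegral P setT (drift k i)) = 0.
  under eq_bigr do rewrite mulrCA.
  by rewrite -mulr_sumr sum_drift mulr0.
rewrite addr0 !mulr_suml; apply: eq_bigr => i _.
have l2 : ln 2 != 0 :> R by rewrite gt_eqF// ln_gt0// ltr1n.
by field; rewrite l2.
Qed.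

Lemma cvg_bit_MI k (e : R^nat) : (forall n, 0 < e n) -> e @ \oo --> (0 : R) ->
  (fun n => bit_MI P H Z p X (e n ^- 2) k / e n ^+ 2) @ \oo -->
  Rintegral P setT (fun t => low_snr_integrand p X k (s t) (h t)) / ln 2.
Proof.
move=> e0 ec; under eq_fun do rewrite bit_MI_rem//.
apply: cvgM; last exact: cvg_cst.
pose l (i : 'I_(2 ^ m)) t :=
  lse_lim (bit_weight p k (bit i k)) (tilt_lin X i (s t)) (tilt_quad X i (h t))
  - lse_lim Psy (tilt_lin X i (s t)) (tilt_quad X i (h t)).
have dct i : integrableR (l i) /\
    (fun n => Rintegral P setT (rem_diff k i (e n))) @ \oo -->
    Rintegral P setT (l i).
  apply: (cvg_Rintegral_dominated _ (integrable_dom_diff k i)).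
  - by move=> n; exact: measurable_rem_diff.
  - by move=> n t; exact: rem_diff_le.
  - move=> t; apply: cvgB; apply: cvg_lse_rem => //.
    + exact: bit_weight_ge0.
    + exact: sum_bit_weight.
have -> : Rintegral P setT (fun t => low_snr_integrand p X k (s t) (h t)) =
    \sum_(i < 2 ^ m) Psym p i * Rintegral P setT (l i).
  rewrite -(Rintegral_lincomb _ (fun i : 'I_(2 ^ m) => Psym p i)); last first.
    by move=> i; have [] := dct i.
  by apply: eq_Rintegral => t _; rewrite -sum_lse_lim.
apply: cvg_sumr => i; apply: cvgM; first exact: cvg_cst.
by have [] := dct i.
Qed.

Lemma cvg_GMI : 0 < EH2 pH * energy p X ->
  has_alpha P H Z pH p X (low_snr_slope P H Z pH p X).
Proof.
rewrite /has_alpha /GMI /low_snr_slope; set c := EH2 pH * _ => c0.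
(* The right limit is tested along positive sequences, to which dominated convergence applies; [e n]
   is [N0 ^ (-1/2)] at SNR [u n]. *)
apply/cvg_at_rightP => u [u0 uc].
pose e n := Num.sqrt (u n / c).
have e0 n : 0 < e n by rewrite sqrtr_gt0 divr_gt0.
have e2 n : e n ^+ 2 = u n / c by rewrite sqr_sqrtr// ltW// divr_gt0.
have ec : e @ \oo --> (0 : R).
  have uc0 : (fun n => u n / c) @ \oo --> (0 : R).
    by rewrite -(mul0r c^-1); apply: cvgM => //; exact: cvg_cst.
  by rewrite -(sqrtr0 R); apply: continuous_cvg => //; exact: sqrt_continuous.
under eq_fun do rewrite mulr_suml.
apply: cvg_sumr => k.
have -> : (fun n => bit_MI P H Z p X (c / u n) k / u n) =
    (fun n => bit_MI P H Z p X (e n ^- 2) k / e n ^+ 2 / c).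
  apply/funext => n; rewrite e2 invf_div.
  by field; rewrite !gt_eqF.
by apply: cvgM; [exact: cvg_bit_MI|exact: cvg_cst].
Qed.

End LowSNR.

(** * The degenerate case and the comparison of slopes *)

Lemma GMI_degenerate (R : realType) (m N : nat) (d0 : measure_display)
    (T : measurableType d0) (P : probability T R) (H Z : 'I_N -> T -> R)
    (pH : R -> R) (p : 'I_m -> R) (X : 'M[R]_(2 ^ m, N)) (snr : R) :
  (0 < N)%N -> EH2 pH * energy p X = 0 -> GMI P H Z pH p X snr = 0.
Proof.
move=> N0 c0; rewrite /GMI c0 mul0r big1// => k _; rewrite /bit_MI big1// => i _.
rewrite (eq_Rintegral _ (g := fun=> 0)) ?Rintegral_cst ?mul0r ?mulr0// => t _ /=.
(* At [N0 = 0] the Gaussian normalisation is the inverse of 0, that is 0. As [N] is positive, every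
   density contains this factor, so the quotient is 0 and [ln 0 = 0]. *)
rewrite /log2 ln0 ?mul0r// /out_dens big1 ?invr0 ?mulr0// => j _.
case: N N0 H Z X {c0} => // N' _ H' Z' X'.
by rewrite /gauss big_ord_recl mulr0 sqrtr0 invr0 !mul0r mulr0.
Qed.

Lemma low_snr_slope_transform (d0 : measure_display) (T : measurableType d0)
    (R : realType) (m N : nat) (P : probability T R) (H Z : 'I_N -> T -> R)
    (pH : R -> R) (p : 'I_m -> R) (X : 'M[R]_(2 ^ m, N)) :
  (forall k, 0 < p k < 1) ->
  low_snr_slope P H Z pH (@unif_bits R m) (transform p X) =
  low_snr_slope P H Z pH p X.
Proof.
move=> hp; apply: eq_bigr => k _; rewrite energy_transform//; congr (_ / _ / _).
apply: eq_Rintegral => t _; rewrite /low_snr_integrand; congr (2 * _ - _).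
  by apply: eq_bigr => d _; rewrite bit_cov_transform.
by apply: eq_bigr => d _; apply: eq_bigr => f _; rewrite bit_cov_transform.
Qed.

Theorem theorem6 (R : realType) (m N : nat) (hm : (1 <= m)%N) (hN : (1 <= N)%N)
  (X : 'M[R]_(2 ^ m, N)) (p0 : 'I_m -> R)
  (hp0 : forall k, 0 < p0 k < 1)
  (d0 : measure_display) (T : measurableType d0) (P : probability T R)
  (H Z : 'I_N -> T -> R) (pH : R -> R)
  (hch : channel_model P H Z pH) :
  let Xo := transform p0 X in
  [/\ mean p0 X = mean (@unif_bits R m) Xo,
      energy p0 X = energy (@unif_bits R m) Xo &
      forall a : R, has_alpha P H Z pH p0 X a <-> has_alpha P H Z pH (@unif_bits R m) Xo a].
Proof.
move=> Xo.
have eE : energy (@unif_bits R m) Xo = energy p0 X by exact: energy_transform.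
split; [by rewrite mean_transform|by rewrite eE|].
have [c0|c0] := eqVneq (EH2 pH * energy p0 X) 0.
  have GE : (fun snr => GMI P H Z pH p0 X snr / snr) =
      (fun snr => GMI P H Z pH (@unif_bits R m) Xo snr / snr).
    by apply/funext => snr; rewrite !GMI_degenerate// eE.
  have transfer (f g : R -> R) a : f = g -> f @ 0^'+ --> a -> g @ 0^'+ --> a.
    by move=> ->.
  by move=> a; split; [exact: transfer GE|exact: transfer (esym GE)].
have c_gt0 : 0 < EH2 pH * energy p0 X.
  rewrite lt_def c0 mulr_ge0//.
    case: hch => _ [_ [_ [pH0 _]]].
    by apply: Rintegral_ge0 => x _; rewrite mulr_ge0 ?sqr_ge0.
  apply: sumr_ge0 => i _; rewrite mulr_ge0//; first by rewrite ltW// Psym_gt0.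
  by apply: sumr_ge0 => d _; exact: sqr_ge0.
have aX := cvg_GMI hch hp0 c_gt0.
have aXo : has_alpha P H Z pH (@unif_bits R m) Xo (low_snr_slope P H Z pH p0 X).
  rewrite -(low_snr_slope_transform P H Z pH X hp0).
  by apply: (cvg_GMI hch (@unif_bits_itv R m)); rewrite eE.
(* Both constellations attain the same limit, so by uniqueness either side of the equivalence forces
   [a] to be that limit. *)
have unique (f : R -> R) (a b : R) : f @ 0^'+ --> a -> f @ 0^'+ --> b -> a = b.
  exact: cvg_unique.
move=> a; split => ha.
  by rewrite (unique _ _ _ ha aX).
by rewrite (unique _ _ _ ha aXo).
Qed.
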